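(* Let $\mathcal{A}$ be an almost commutative algebra (with respect to an abelian group $G$ and cocycle $\rho$). Then the $\rho$-Lie bracket on $\rho\mathrm{Der}(\mathcal{A})$ is identified, via $X\mapsto i_X$, with the derived $\rho'$-antibracket with respect to the de Rham differential: for all $X,Y\in\rho\mathrm{Der}(\mathcal{A})$, as sections of $\Omega_0^\bullet(\mathcal{A})$, $$[\![i_X,i_Y]\!]_{\mathrm{d}}:=[[\mathrm{d},i_X]_{\rho'},i_Y]_{\rho'}=i_{[X,Y]_\rho}.$$
   Context: Let $\mathbb{K}=\mathbb{R}$ or $\mathbb{C}$ and let $G$ be an abelian group written additively. A cocycle is a map $\rho:G\times G\to\mathbb{K}$ with $\rho(a,b)=\rho(b,a)^{-1}$ and $\rho(a+b,c)=\rho(a,c)\rho(b,c)$. For a $G$-graded associative unital $\mathbb{K}$-algebra $\mathcal{A}$, $|f|\in G$ denotes the degree of homogeneous $f$ and $[f,g]_\rho:=fg-\rho(|f|,|g|)gf$ is the $\rho$-commutator (extended linearly; all formulas are for homogeneous elements); the same formula is used for homogeneous linear maps. $\mathcal{A}$ is almost commutative ($\rho$-commutative) if $[f,g]_\rho=0$ for all $f,g$. A $\rho$-derivation $X$ of $\mathcal{A}$ of $G$-degree $|X|$ is a linear map of that degree with $X(fg)=(Xf)g+\rho(|X|,|f|)f(Xg)$; $\rho\mathrm{Der}(\mathcal{A})$ is the $G$-graded space of all $\rho$-derivations, a left $\mathcal{A}$-module via $(fX)g=f(Xg)$, with bracket $[-,-]_\rho$. Differential forms: $\Omega^0(\mathcal{A}):=\mathcal{A}$,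 and for $p\ge1$, $\Omega^p(\mathcal{A})$ is the $G$-graded space of $p$-linear maps $\alpha_p$ on $\rho\mathrm{Der}(\mathcal{A})$ with values in $\mathcal{A}$, written $(X_1,\dots,X_p)\mapsto\langle X_1,\dots,X_p|\alpha_p\rangle$, satisfying $\langle fX_1,X_2,\dots,X_p|\alpha_p\rangle=f\langle X_1,\dots,X_p|\alpha_p\rangle$ and $\langle\dots,X_i,X_{i+1},\dots|\alpha_p\rangle=-\rho(|X_i|,|X_{i+1}|)\langle\dots,X_{i+1},X_i,\dots|\alpha_p\rangle$. The $G$-degree is $|\alpha_p|=|\langle X_1,\dots,X_p|\alpha_p\rangle|-(|X_1|+\dots+|X_p|)$, and $\langle X_1,\dots,X_p|\alpha_pf\rangle=\langle X_1,\dots,X_p|\alpha_p\rangle f$ defines a right $\mathcal{A}$-module structure. Set $\Omega^\bullet(\mathcal{A})=\bigoplus_{p\ge0}\Omega^p(\mathcal{A})$, graded by $G'=\mathbb{Z}\times G$ with $|\alpha_p|'=(p,|\alpha_p|)$, and $\rho'((p,a),(q,b)):=(-1)^{pq}\rho(a,b)$. For $X\in\rho\mathrm{Der}(\mathcal{A})$ the interior derivative is $i_Xf=0$ for $f\in\mathcal{A}$ and $\langle X_1,\dots,X_{p-1}|i_X\alpha_p\rangle:=\rho\big(\sum_{l=1}^{p-1}|X_l|,|X|\big)\langle X,X_1,\dots,X_{p-1}|\alpha_p\rangle$. $\Omega^\bullet(\mathcal{A})$ carries the natural (wedge) product making it an associative $\rho'$-commutative $G'$-graded algebra; it is determined by extending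 the product of $\mathcal{A}$ and the right $\mathcal{A}$-action $(\alpha_p,f)\mapsto\alpha_pf$ given by $\langle X_1,\dots,X_p|\alpha_pf\rangle=\langle X_1,\dots,X_p|\alpha_p\rangle f$, and by every $i_X$ being a $\rho'$-derivation of $G'$-degree $(-1,|X|)$. Let $\mathrm{d}f\in\Omega^1(\mathcal{A})$ be given by $\langle X|\mathrm{d}f\rangle=X(f)$ for $f\in\mathcal{A}$. $\Omega_0^0(\mathcal{A}):=\mathcal{A}$, $\Omega_0^1(\mathcal{A}):=\{\sum_k\mathrm{d}f_k\,g_k\mid f_k,g_k\in\mathcal{A}\}$ (finite sums), and $\Omega_0^\bullet(\mathcal{A})$ is the $\rho'$-commutative subalgebra of $\Omega^\bullet(\mathcal{A})$ generated by $\mathcal{A}$ and $\Omega_0^1(\mathcal{A})$; it is preserved by each $i_X$. On $\Omega_0^\bullet(\mathcal{A})$ the de Rham differential $\mathrm{d}$ is the $\rho'$-derivation of $G'$-degree $(1,0)$ extending $f\mapsto\mathrm{d}f$ with $\mathrm{d}^2=0$. Weight is the form degree, and $(\Omega^\bullet_0(\mathcal{A}),\mathrm{d})$ is regarded as an almost commutative $Q$-algebra of degree $1$, whose sections are the $\rho'$-derivations of $\Omega_0^\bullet(\mathcal{A})$ of negative weight. *)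

(* Defs.v *)
From HB Require Import structures.
From mathcomp Require Import all_boot all_order all_algebra.
From mathcomp Require Import boolp classical_sets functions cardinality fsbigop.
From mathcomp Require Import reals complex.
Set Implicit Arguments.
Unset Strict Implicit.
Unset Printing Implicit Defensive.
Import Order.TTheory GRing.Theory Num.Theory.
Local Open Scope classical_set_scope.
Local Open Scope ring_scope.

Inductive real_or_complex : fieldType -> Prop :=
| ground_real (R : realType) : real_or_complex R
| ground_complex (R : realType) : real_or_complex R[i].

Section Graded.
Context {K : fieldType} {I : zmodType}.

Section OneSpace.
Variables (V : lmodType K) (hom : I -> set V).
Implicit Types (v : V) (w : I -> V).

Definition is_decomp v w : Prop :=
  [/\ finite_set [set i | w i != 0], forall i, hom i (w i)
    & v = \sum_(i \in [set: I]) w i].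

(* [V] is the internal direct sum of the subspaces [hom i] *)
Record is_grading : Prop := IsGrading {
  hom0 : forall i, hom i 0;
  hom_lin : forall i c u v, hom i u -> hom i v -> hom i (c *: u + v);
  hom_decomp : forall v, exists! w, is_decomp v w }.

(* the family of homogeneous components of [v] *)
Definition hpart v : I -> V := xget (fun=> 0) (is_decomp v).

Inductive hspan : V -> Prop :=
| hspan_zero : hspan 0
| hspan_cons i c u v : hom i u -> hspan v -> hspan (c *: u + v).

Definition hspan_pred : {pred V} := fun v => `[< hspan v >].

Lemma hspan_linear c u v : hspan u -> hspan v -> hspan (c *: u + v).
Proof.
move=> hu hv; elim: hu => [|i e x y hx _ IH]; first by rewrite scaler0 add0r.
by rewrite scalerDr scalerA -addrA; apply: hspan_cons hx IH.
Qed.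

Lemma hspanD u v : hspan u -> hspan v -> hspan (u + v).
Proof. by move=> hu hv; rewrite -[u]scale1r; apply: hspan_linear. Qed.

Lemma hspanZ c u : hspan u -> hspan (c *: u).
Proof. by move=> hu; rewrite -[_ *: _]addr0; apply: hspan_linear hu hspan_zero. Qed.

Lemma hspan_hom i u : hom i u -> hspan u.
Proof.
by move=> hu; rewrite -[u]scale1r -[_ *: _]addr0; apply: hspan_cons hu hspan_zero.
Qed.

Lemma hspan_sum (T : Type) (s : seq T) (F : T -> V) :
  (forall t, hspan (F t)) -> hspan (\sum_(t <- s) F t).
Proof.
move=> hF; elim: s => [|t s IH]; first by rewrite big_nil; apply: hspan_zero.
by rewrite big_cons; apply: hspanD.
Qed.

Lemma hspan_closed : subsemimod_closed hspan_pred.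
Proof.
split; first split.
- by apply/asboolP/hspan_zero.
- by move=> u v /asboolP hu /asboolP hv; apply/asboolP/hspanD.
- by move=> c u /asboolP hu; apply/asboolP/hspanZ.
Qed.

(* the span of the homogeneous elements as a type: the graded space
   that is the sum of the [hom i], [dhom] being the grading *)
Record dsum : Type := DSum { dsum_val : V; _ : hspan_pred dsum_val }.
HB.instance Definition _ := [isSub for dsum_val].
HB.instance Definition _ := [Choice of dsum by <:].
HB.instance Definition _ := GRing.SubChoice_isSubLmodule.Build K V hspan_pred dsum
  hspan_closed.

Definition dhom (i : I) : set dsum := [set x | hom i (val x)].

Definition mk_dsum v (hv : hspan v) : dsum := @DSum v (asboolT hv).

Lemma dsumP (x : dsum) : hspan (val x).
Proof. exact/asboolP/(valP x). Qed.

End OneSpace.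

(* This grades only the span of the homogeneous linear maps, not all of
   [V -> V]; on that span [hpart] still gives the homogeneous components. *)
Definition hom_map (V : lmodType K) (hom : I -> set V) (u : I) : set (V -> V) :=
  [set F | linear F /\ forall i x, hom i x -> hom (u + i) (F x)].

(* [mul f g - rho |f| |g| *: mul g f] for homogeneous [f] and [g], extended
   bilinearly through the homogeneous components *)
Definition rho_comm (rho : I -> I -> K) (V W : lmodType K) (hom : I -> set V)
    (mul : V -> V -> W) (f g : V) : W :=
  \sum_(i \in [set: I]) \sum_(j \in [set: I])
    (mul (hpart hom f i) (hpart hom g j)
     - rho i j *: mul (hpart hom g j) (hpart hom f i)).

Definition is_rho_derivation (rho : I -> I -> K) (V : lmodType K)
    (hom : I -> set V) (mul : V -> V -> V) (u : I) : set (V -> V) :=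
  [set D | hom_map hom u D /\
     forall i f g, hom i f ->
       D (mul f g) = mul (D f) g + rho u i *: mul f (D g)].

Lemma finite_fsum (S : set I) : finite_set S ->
  exists s : seq I, [/\ uniq s, forall i, i \notin s -> ~ S i,
    forall i, S i -> i \in s &
    forall (W : lmodType K) (phi : I -> W), (forall i, i \notin s -> phi i = 0) ->
      \sum_(i \in [set: I]) phi i = \sum_(i <- s) phi i].
Proof.
move=> fS; exists (finmap.enum_fset (fset_set S)).
have memS i : (i \in finmap.enum_fset (fset_set S)) = (i \in S) := in_fset_set fS i.
split.
- exact: finmap.fset_uniq.
- by move=> i; rewrite memS => /negP ni h; apply: ni; apply/mem_set.
- by move=> i h; rewrite memS; apply/mem_set.
by move=> W phi h; apply: fsbigTE => i ni; apply: h.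
Qed.

Lemma finite_fsum2 (V : lmodType K) (w w' : I -> V) :
  finite_set [set i | w i != 0] -> finite_set [set i | w' i != 0] ->
  exists s : seq I, [/\ uniq s, forall i, i \notin s -> (w i = 0) * (w' i = 0) &
    forall (W : lmodType K) (phi : I -> W), (forall i, i \notin s -> phi i = 0) ->
      \sum_(i \in [set: I]) phi i = \sum_(i <- s) phi i].
Proof.
move=> f f'; have : finite_set ([set i | w i != 0] `|` [set i | w' i != 0]).
  by rewrite finite_setU.
move=> /finite_fsum[s [us out _ E]]; exists s; split=> // i /out ni.
by split; apply/eqP/negPn/negP => h; apply: ni; [left|right].
Qed.

Section Theory.
Variables (V : lmodType K) (hom : I -> set V).
Hypothesis homG : is_grading hom.

Lemma hpartP v : is_decomp hom v (hpart hom v).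
Proof. by rewrite /hpart; apply: xgetPex; have [w [hw _]] := hom_decomp homG v; exists w. Qed.

Lemma hpart_uniq v w : is_decomp hom v w -> hpart hom v = w.
Proof. by move=> hw; have [w' [_ h]] := hom_decomp homG v; rewrite -(h _ hw) -(h _ (hpartP v)). Qed.

Lemma hpart_hom v i : hom i (hpart hom v i).
Proof. by case: (hpartP v). Qed.

Lemma hpart_id i v : hom i v -> hpart hom v = fun j => if j == i then v else 0.
Proof.
move=> hv; apply: hpart_uniq; split.
- apply: (@sub_finite_set _ _ [set i]); last exact: finite_set1.
  by move=> j /=; case: (eqVneq j i) => // _; rewrite eqxx.
- by move=> j; case: eqP => [->//|_]; apply: (hom0 homG).
rewrite (fsbigE [:: i]) //=; first by rewrite big_cons big_nil in_setT eqxx addr0.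
by move=> j _ /=; case: eqP => // ->; rewrite inE eqxx.
Qed.

Lemma hpart_linear c u v :
  hpart hom (c *: u + v) = fun i => c *: hpart hom u i + hpart hom v i.
Proof.
have [fu hu eu] := hpartP u; have [fv hv ev] := hpartP v.
apply: hpart_uniq; set wu := hpart hom u in fu hu eu *.
set wv := hpart hom v in fv hv ev *.
have [s [_ out E]] := finite_fsum2 fu fv.
split; last 1 first.
- rewrite {1}eu {1}ev !E; last 3 first.
  + by move=> i /out[-> ->]; rewrite scaler0 addr0.
  + by move=> i /out[].
  + by move=> i /out[].
  by rewrite big_split /= scaler_sumr.
- apply: (@sub_finite_set _ _ ([set i | wu i != 0] `|` [set i | wv i != 0])).
    move=> i /=; case: (eqVneq (wu i) 0) => [->|]; last by left.
    by rewrite scaler0 add0r; right.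
  by rewrite finite_setU.
by move=> i; apply: (hom_lin homG).
Qed.

Lemma hpart0 i : hpart hom 0 i = 0.
Proof. by rewrite (hpart_id (hom0 homG i)) eqxx. Qed.

Lemma grading_span v : hspan hom v.
Proof.
have [_ hw ->] := hpartP v; apply: hspan_sum => i; exact: hspan_hom (hw i).
Qed.

Lemma homZ i c u : hom i u -> hom i (c *: u).
Proof. by move=> hu; rewrite -[_ *: _]addr0; apply: (hom_lin homG) hu (hom0 homG i). Qed.

Lemma fsum_hpart_linear (W : lmodType K) (phi : I -> V -> W) :
  (forall i, linear (phi i)) ->
  linear (fun v => \sum_(i \in [set: I]) phi i (hpart hom v i)).
Proof.
move=> lphi c u v; have p0 i : phi i 0 = 0.
  by have := lphi i (-1) 0 0; rewrite scaler0 addr0 => ->; rewrite scaleN1r addNr.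
have [fu _ _] := hpartP u; have [fv _ _] := hpartP v.
rewrite hpart_linear; set wu := hpart hom u in fu *; set wv := hpart hom v in fv *.
have [s [_ out E]] := finite_fsum2 fu fv.
rewrite !E; last 3 first.
- by move=> i /out[_ ->].
- by move=> i /out[-> _].
- by move=> i /out[-> ->]; rewrite scaler0 addr0.
rewrite scaler_sumr -big_split /=; apply: eq_bigr => i _; exact: lphi.
Qed.

Lemma fsum_hpart_id (W : lmodType K) (phi : I -> V -> W) i v :
  (forall j, phi j 0 = 0) -> hom i v ->
  \sum_(j \in [set: I]) phi j (hpart hom v j) = phi i v.
Proof.
move=> p0 hv; rewrite (hpart_id hv) (fsbigE [:: i]) //=.
  by rewrite big_cons big_nil in_setT eqxx addr0.
by move=> j _ /=; case: eqP => [->|_]; rewrite ?inE ?eqxx // p0.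
Qed.

End Theory.

Lemma gradingI (V : lmodType K) (hom : I -> set V) :
  (forall i, hom i 0) ->
  (forall i c u v, hom i u -> hom i v -> hom i (c *: u + v)) ->
  (forall v, hspan hom v) ->
  (forall (w : I -> V) (s : seq I), uniq s -> (forall i, hom i (w i)) ->
     \sum_(i <- s) w i = 0 -> forall i, i \in s -> w i = 0) ->
  is_grading hom.
Proof.
move=> h0 hl hs hi; split=> // v.
have hB i u v' : hom i u -> hom i v' -> hom i (u - v').
  by move=> hu hv; rewrite addrC -scaleN1r; apply: hl.
suff [w hw] : exists w, is_decomp hom v w.
  exists w; split=> // w' hw'; have [f h e] := hw; have [f' h' e'] := hw'.
  have [s [us out E]] := finite_fsum2 f f'.
  apply/funext => i; case: (boolP (i \in s)) => [si|/out[-> ->]//].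
  apply/eqP; rewrite -subr_eq0; apply/eqP.
  apply: (hi (fun i => w i - w' i) s) => //.
  - by move=> j; apply: hB.
  rewrite sumrB -!E.
  - by rewrite -e -e' subrr.
  - by move=> j /out[].
  - by move=> j /out[].
elim: (hs v) => [|i c u x hu _ [w [fw hw ex]]].
  exists (fun=> 0); split=> //.
    by apply: (@sub_finite_set _ _ set0) => // j /=; rewrite eqxx.
  by rewrite fsbig1.
exists (fun j => (if j == i then c *: u else 0) + w j).
have fw2 : finite_set ([set i] `|` [set i | w i != 0]).
  by rewrite finite_setU; split => //; exact: finite_set1.
split.
- apply: sub_finite_set fw2 => j /=; case: (eqVneq j i) => [->|_]; first by left.
  by rewrite add0r; right.
- move=> j; case: eqP => [->|_]; last by rewrite add0r.
  by apply: hl.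
have [s [us out ins E]] := finite_fsum fw2.
have w0 j : j \notin s -> w j = 0.
  by move=> /out nj; apply/eqP/negPn/negP => h; apply: nj; right.
have n0 j : j \notin s -> (j == i) = false.
  by move=> /out nj; apply/eqP => h; apply: nj; left.
rewrite ex !E; last 2 first.
- by move=> j nj; rewrite n0 // w0 // addr0.
- exact: w0.
rewrite big_split /=; congr (_ + _).
rewrite (bigD1_seq i) //=; last by apply: ins; left.
by rewrite eqxx big1 ?addr0 // => j /negPf ->.
Qed.

End Graded.

(* [cocycle_neq0] makes the values invertible, since [0^-1 = 0] here *)
Record cocycle (K : fieldType) (G : zmodType) := Cocycle {
  cocycle_fun :> G -> G -> K;
  cocycle_neq0 : forall a b, cocycle_fun a b != 0;
  cocycleV : forall a b, cocycle_fun a b = (cocycle_fun b a)^-1;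
  cocycleD : forall a b c,
    cocycle_fun (a + b) c = cocycle_fun a c * cocycle_fun b c }.

Record acAlgebra (K : fieldType) (G : zmodType) (rho : cocycle K G) := ACAlgebra {
  ac_carrier :> algType K;
  ac_hom : G -> set ac_carrier;
  ac_grading : is_grading ac_hom;
  ac_homM : forall a b f g, ac_hom a f -> ac_hom b g -> ac_hom (a + b) (f * g);
  ac_comm : forall f g, rho_comm rho ac_hom *%R f g = 0 }.

Section Forms.
Context {K : fieldType} {G : zmodType} {rho : cocycle K G}.

Lemma cocycleVM a b : rho a b * rho b a = 1.
Proof. by rewrite (cocycleV rho a b) mulVf // cocycle_neq0. Qed.

Lemma cocycleDr a b c : rho a (b + c) = rho a b * rho a c.
Proof.
by rewrite (cocycleV rho a) cocycleD invfM -!(cocycleV rho a).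
Qed.

Section OneAlgebra.
Variable A : acAlgebra rho.
Implicit Types f g : A.
Local Notation homA := (@ac_hom K G rho A).
Let GA := ac_grading A.

Lemma ac_homC a b f g : homA a f -> homA b g -> f * g = rho a b *: (g * f).
Proof.
move=> hf hg; apply/eqP; rewrite -subr_eq0; apply/eqP.
rewrite -[RHS](ac_comm f g) /rho_comm.
rewrite (fsum_hpart_id GA (i := a) (v := f) (phi := fun i u =>
  \sum_(j \in [set: G]) (u * hpart homA g j - rho i j *: (hpart homA g j * u)))) //.
  rewrite (fsum_hpart_id GA (i := b) (v := g) (phi := fun j u =>
    (f * u - rho a j *: (u * f)))) // => j.
  by rewrite mulr0 mul0r scaler0 subr0.
by move=> i; rewrite fsbig1 // => j _; rewrite mul0r mulr0 scaler0 subr0.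
Qed.

Definition der_hom : G -> set (A -> A) := is_rho_derivation rho homA *%R.

Definition rder : Type := dsum der_hom.
HB.instance Definition _ := GRing.Lmodule.on rder.
Definition rder_hom : G -> set rder := dhom (hom := der_hom).
Definition rder_fun (X : rder) : A -> A := val X.
Coercion rder_fun : rder >-> Funclass.

Lemma rder_funE c (X Y : rder) f : rder_fun (c *: X + Y) f = c *: X f + Y f.
Proof. by []. Qed.

Lemma rder_linear (X : rder) : linear X.
Proof.
rewrite /rder_fun; elim: (dsumP X) => [|a e D E [[lD _] _] _ lE] c u v.
  by rewrite /= scaler0 addr0.
rewrite !fctE /= lD lE !scalerDr !scalerA (mulrC e) -!addrA; congr (_ + _).
by rewrite addrCA.
Qed.

Lemma lin0 (V W : lmodType K) (F : V -> W) : linear F -> F 0 = 0.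
Proof. by move=> lF; have := lF (-1) 0 0; rewrite scaler0 addr0 scaleN1r addNr. Qed.

Lemma linD (V W : lmodType K) (F : V -> W) u v : linear F -> F (u + v) = F u + F v.
Proof. by move=> lF; have := lF 1 u v; rewrite !scale1r. Qed.

Lemma linZ (V W : lmodType K) (F : V -> W) c u : linear F -> F (c *: u) = c *: F u.
Proof. by move=> lF; rewrite -[c *: u]addr0 lF lin0 // addr0. Qed.

Lemma lin_sum (V W : lmodType K) (F : V -> W) (T : Type) (s : seq T) (w : T -> V) :
  linear F -> F (\sum_(t <- s) w t) = \sum_(t <- s) F (w t).
Proof.
move=> lF; elim: s => [|t s IH]; first by rewrite !big_nil lin0.
by rewrite !big_cons linD // IH.
Qed.

Lemma hspan_elim (V : lmodType K) (I : zmodType) (hom : I -> set V) (P : V -> Prop) :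
  P 0 -> (forall c u v, P u -> P v -> P (c *: u + v)) ->
  (forall i v, hom i v -> P v) -> forall v, hspan hom v -> P v.
Proof.
by move=> P0 Pl Ph v; elim=> // i c x y hx _ Py; apply: Pl => //; apply: Ph hx.
Qed.

Lemma der_hom_zero a : der_hom a 0.
Proof.
split; first split.
- by move=> c u v; rewrite /= scaler0 addr0.
- by move=> i x _; apply: (hom0 GA).
by move=> i f g _; rewrite mul0r mulr0 scaler0 addr0.
Qed.

Lemma der_hom_lin a c (D E : A -> A) :
  der_hom a D -> der_hom a E -> der_hom a (c *: D + E).
Proof.
move=> [[lD hD] dD] [[lE hE] dE]; split; first split.
- move=> e u v; rewrite !fctE /= lD lE !scalerDr !scalerA (mulrC e) -!addrA.
  by congr (_ + _); rewrite addrCA.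
- by move=> i x hx; apply: (hom_lin GA); [apply: hD|apply: hE].
move=> i f g hf; rewrite !fctE /= (dD i) // (dE i) // !scalerDr !mulrDl !mulrDr.
rewrite !scalerDr -!scalerAl -!scalerAr !scalerA (mulrC c) -!addrA.
by congr (_ + _); rewrite addrCA.
Qed.

Lemma rder_grading : is_grading rder_hom.
Proof.
apply: gradingI.
- exact: der_hom_zero.
- by move=> i c u v; apply: der_hom_lin.
- case=> D hD; have := hD; move/asboolP => sD; move: hD.
  elim: sD => [|a c u v hu sv IH] hD.
    have -> : DSum hD = 0 by apply: val_inj.
    exact: hspan_zero.
  pose U := mk_dsum (hspan_hom hu); pose V := mk_dsum sv.
  have -> : DSum hD = c *: U + V by apply: val_inj.
  by apply: (hspan_cons (i := a)) => //; apply: IH.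
move=> w s us hw e i si; apply: val_inj; apply/funext => x.
change (rder_fun (w i) x = 0).
have lw j : linear (rder_fun (w j)) by apply: rder_linear.
apply: (@hspan_elim A G homA (fun x => rder_fun (w i) x = 0) _ _ _ x (grading_span GA x)).
- by rewrite lin0.
- by move=> c u v hu hv; rewrite lw hu hv scaler0 addr0.
move=> b v hv.
have E : \sum_(j <- s) rder_fun (w j) v = 0.
  have -> : \sum_(j <- s) rder_fun (w j) v = rder_fun (\sum_(j <- s) w j) v.
    by elim: s {us e si} => [|j s IH]; rewrite ?big_nil ?big_cons //= IH.
  by rewrite e.
have hwv j : homA (j + b) (rder_fun (w j) v) by case: (hw j) => -[_ h] _; apply: h.
have p0 := hpart0 GA.
pose ws := fun k : G => if k - b \in s then rder_fun (w (k - b)) v else 0.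
have dec : is_decomp homA 0 ws.
  split.
  - apply: (@sub_finite_set _ _ [set` [seq j + b | j <- s]]); last exact: finite_seq.
    move=> k /=; rewrite /ws; case: ifP => [ks _|]; last by rewrite eqxx.
    by apply/mapP; exists (k - b) => //; rewrite subrK.
  - move=> k; rewrite /ws; case: ifP => _; last exact: (hom0 GA).
    by have := hwv (k - b); rewrite subrK.
  rewrite (fsbigE [seq j + b | j <- s]) //=.
  - rewrite big_map -[LHS]E big_seq [RHS]big_seq_cond; apply: eq_big => j.
      by rewrite in_setT andbT.
    by move=> js; rewrite /ws addrK js.
  - by rewrite map_inj_uniq //; apply: addIr.
  move=> k _; rewrite /ws; case: ifP => // ks /mapP[]; exists (k - b) => //.
  by rewrite subrK.
have := hpart_uniq GA dec => /(congr1 (fun F => F (i + b))).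
by rewrite p0 /ws addrK si => <-.
Qed.

Lemma amul_proof f (X : rder) : hspan der_hom (fun g => f * X g).
Proof.
rewrite /rder_fun; elim: (dsumP X) => [|a c D E hD _ IH].
  rewrite (_ : (fun _ => _) = 0); first exact: hspan_zero.
  by apply/funext => g; rewrite /= mulr0.
rewrite (_ : (fun _ => _) = c *: (fun g => f * D g) + (fun g => f * E g)).
  apply: hspan_linear => // {IH}.
  apply: (@hspan_elim A G homA (fun f => hspan der_hom (fun g => f * D g)) _ _ _ f
    (grading_span GA f)).
  - rewrite (_ : (fun _ => _) = 0); first exact: hspan_zero.
    by apply/funext => g; rewrite mul0r.
  - move=> e u v hu hv; have := hspan_linear e hu hv; congr hspan.
    by apply/funext => g; rewrite !fctE /= mulrDl scalerAl.
  move=> b u hu; apply: (@hspan_hom _ _ _ _ (b + a)); case: hD => [[lD hD] dD].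
  split; first split.
  - by move=> e x y; rewrite /= lD mulrDr scalerAr.
  - by move=> i x hx; rewrite -addrA; apply: ac_homM => //; apply: hD.
  move=> i x y hx; rewrite (dD i) // mulrDr mulrA; congr (_ + _).
  by rewrite -scalerAr mulrA (ac_homC hu hx) -scalerAl scalerA -mulrA cocycleD
    (mulrC (rho a i)).
by apply/funext => g; rewrite !fctE /= mulrDr scalerAr.
Qed.

(* the left A-module structure *)
Definition amul f (X : rder) : rder := mk_dsum (amul_proof f X).

Lemma der_hom_comm a b (D E : A -> A) : der_hom a D -> der_hom b E ->
  der_hom (a + b) (D \o E - rho a b *: (E \o D)).
Proof.
move=> [[lD hD] dD] [[lE hE] dE]; split; first split.
- move=> c u v; rewrite !fctE /= lD lE lE lD !scalerDr !opprD !scalerN !scalerA.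
  by rewrite (mulrC c) addrACA.
- move=> i x hx; rewrite !fctE /= -scaleNr addrC; apply: (hom_lin GA).
    by rewrite [X in homA X](_ : _ = b + (a + i)); [apply: hE; apply: hD|rewrite addrCA addrA].
  by rewrite -addrA; apply: hD; apply: hE.
move=> i f g hf; rewrite !fctE /=.
rewrite (dE i) // (dD i) // (linD _ _ lD) (linD _ _ lE) (linZ _ _ lD) (linZ _ _ lE).
rewrite (dD _ _ _ (hE _ _ hf)) (dD _ _ _ hf) (dE _ _ _ (hD _ _ hf)) (dE _ _ _ hf).
rewrite !scalerDr !scalerA !cocycleDr !cocycleD mulrBl mulrBr !scalerBr.
rewrite -!scalerAl -!scalerAr !scalerA !mulrA cocycleVM mul1r.
have aux (P Q R S P' S' : A) : P + Q + (R + S) - (P' + R + (Q + S')) = (P - P') + (S - S').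
  rewrite (addrC P Q) (addrACA Q P R S) (addrC P' R) (addrACA R P' Q S') (addrC R Q).
  by rewrite opprD (addrACA (Q + R)) subrr add0r opprD addrACA.
rewrite aux; congr (_ + (_ - _)); first by rewrite [rho b i * _]mulrC.
by rewrite [in LHS]mulrC -!mulrA; congr (_ *: _); rewrite !mulrA mulrC !mulrA (mulrC _ (rho a b)) !mulrA.
Qed.

Lemma rder_bracket_proof (X Y : rder) : hspan der_hom
  (rho_comm rho rder_hom (fun X Y : rder => (X : A -> A) \o (Y : A -> A)) X Y).
Proof.
apply: hspan_sum => a; apply: hspan_sum => b; apply: (@hspan_hom _ _ _ _ (a + b)).
by apply: der_hom_comm; apply: (hpart_hom rder_grading).
Qed.

Definition rder_bracket (X Y : rder) : rder := mk_dsum (rder_bracket_proof X Y).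

(* A form of degree p is a function on all sequences of derivations vanishing
   unless the length is p; the direct sum over p is then a subspace of the
   functions on sequences. *)
Record is_form (p : nat) (a : G) (alpha : seq rder -> A) : Prop := IsForm {
  form_size : forall s, size s != p -> alpha s = 0;
  form_linear : forall s1 s2 c X Y,
    alpha (s1 ++ (c *: X + Y) :: s2) =
    c *: alpha (s1 ++ X :: s2) + alpha (s1 ++ Y :: s2);
  form_amul : forall f X s, alpha (amul f X :: s) = f * alpha (X :: s);
  form_swap : forall s1 s2 b c X Y, rder_hom b X -> rder_hom c Y ->
    alpha (s1 ++ X :: Y :: s2) = - rho b c *: alpha (s1 ++ Y :: X :: s2);
  form_deg : forall s : seq (G * rder), size s = p ->
    (forall x, x \in s -> rder_hom x.1 x.2) ->
    homA (a + \sum_(x <- s) x.1) (alpha [seq x.2 | x <- s]) }.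

Local Notation bideg := (int * G)%type.

Definition rho' (u v : bideg) : K := (-1) ^ (u.1 * v.1) * rho u.2 v.2.

Definition form_raw_hom (u : bideg) : set (seq rder -> A) :=
  [set alpha | if u.1 is Posz p then is_form p u.2 alpha else alpha = 0].

Definition dform : Type := dsum form_raw_hom.
HB.instance Definition _ := GRing.Lmodule.on dform.
Definition form_fun (alpha : dform) : seq rder -> A := val alpha.
Coercion form_fun : dform >-> Funclass.
Definition form_hom : bideg -> set dform := dhom (hom := form_raw_hom).

(* A homogeneous Y of degree b is sent to rho(b,a) Y. By multilinearity,
   twisting every X_l yields the factor rho(|X_1| + ... + |X_n|, a) of the
   interior derivative and extends it to inhomogeneous arguments. *)
Definition twist (a : G) (Y : rder) : rder :=
  \sum_(b \in [set: G]) rho b a *: hpart rder_hom Y b.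

Definition interior_raw (X : rder) (alpha : seq rder -> A) (s : seq rder) : A :=
  \sum_(a \in [set: G]) alpha (hpart rder_hom X a :: map (twist a) s).

Definition interior1 (a : G) (X : rder) (alpha : seq rder -> A) : seq rder -> A :=
  fun s => alpha (X :: map (twist a) s).

Lemma twist_linear a : linear (twist a).
Proof.
apply: (fsum_hpart_linear rder_grading (phi := fun b Y => rho b a *: Y)).
by move=> b c u v; rewrite scalerDr !scalerA mulrC.
Qed.

Lemma twist_hom a b Y : rder_hom b Y -> twist a Y = rho b a *: Y.
Proof.
move=> hY; apply: (fsum_hpart_id rder_grading (phi := fun b Y => rho b a *: Y)) => //.
by move=> j; rewrite scaler0.
Qed.

Lemma amul_hom b a f X : homA b f -> rder_hom a X -> rder_hom (b + a) (amul f X).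
Proof.
move=> hf [[lD hD] dD]; rewrite /rder_hom /dhom /=; split; first split.
- by move=> e x y; rewrite /rder_fun lD mulrDr scalerAr.
- by move=> i x hx; rewrite -addrA; apply: ac_homM => //; apply: hD.
move=> i x y hx; rewrite /rder_fun (dD i) // mulrDr mulrA; congr (_ + _).
by rewrite -scalerAr mulrA (ac_homC hf hx) -scalerAl scalerA -mulrA cocycleD
    (mulrC (rho a i)).
Qed.

Lemma amul_linl X : linear (fun f => amul f X).
Proof.
move=> c u v; apply: val_inj; apply/funext => g.
by rewrite /= !fctE /= mulrDl scalerAl.
Qed.

Lemma amul_linr f : linear (amul f).
Proof.
move=> c u v; apply: val_inj; apply/funext => g.
by rewrite /= /rder_fun /= !fctE /= mulrDr scalerAr.
Qed.

Lemma rder_ind (P : rder -> Prop) :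
  P 0 -> (forall c u v, P u -> P v -> P (c *: u + v)) ->
  (forall i v, rder_hom i v -> P v) -> forall v, P v.
Proof. by move=> p0 pl ph v; apply: hspan_elim (grading_span rder_grading v). Qed.

Lemma twist_amul a b f Y : homA b f -> twist a (amul f Y) = rho b a *: amul f (twist a Y).
Proof.
move=> hf; elim/rder_ind: Y => [|c u v hu hv|i Y hY].
- by rewrite (lin0 (amul_linr f)) (lin0 (twist_linear a)) (lin0 (amul_linr f)) scaler0.
- by rewrite amul_linr !twist_linear amul_linr hu hv scalerDr !scalerA (mulrC c).
by rewrite (twist_hom a hY) (twist_hom a (amul_hom hf hY)) (linZ _ _ (amul_linr f))
  cocycleD scalerA.
Qed.

Section OneForm.
Variables (p : nat) (c : G) (alpha : seq rder -> A).
Hypothesis h : is_form p c alpha.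

Lemma form_lin_at s1 s2 : linear (fun X => alpha (s1 ++ X :: s2)).
Proof. by move=> e X Y; apply: form_linear h _ _ _ _ _. Qed.

Lemma form_lin_second X s : linear (fun Y => alpha (X :: Y :: s)).
Proof. exact: form_lin_at [:: X] s. Qed.

Lemma form_amul_second a X b f Y s : rder_hom a X -> homA b f ->
  alpha (X :: amul f Y :: s) = rho a b *: (f * alpha (X :: Y :: s)).
Proof.
move=> hX hf; elim/rder_ind: Y => [|e u v hu hv|i Y hY].
- rewrite (lin0 (amul_linr f)) (lin0 (form_lin_second X s)).
  by rewrite mulr0 scaler0.
- rewrite amul_linr !(form_lin_second X s) hu hv mulrDr scalerDr !scalerA.
  by rewrite -scalerAr scalerA (mulrC e).
rewrite (form_swap h [::] s hX (amul_hom hf hY)) /= (form_amul h).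
rewrite (form_swap h [::] s hX hY) /= cocycleDr -scalerAr scalerA.
by rewrite mulrN.
Qed.

End OneForm.

Lemma interior1_form p a c X alpha : rder_hom a X -> is_form p.+1 c alpha ->
  is_form p (c + a) (interior1 a X alpha).
Proof.
move=> hX h; rewrite /interior1; split.
- by move=> s ns; apply: (form_size h); rewrite /= size_map eqSS.
- move=> s1 s2 e Y Z; rewrite !map_cat /= twist_linear.
  exact: (form_linear h (X :: map (twist a) s1)).
- move=> f Y s; rewrite /=; apply: (@hspan_elim A G homA (fun f =>
    alpha (X :: twist a (amul f Y) :: map (twist a) s) =
    f * alpha (X :: twist a Y :: map (twist a) s)) _ _ _ f (grading_span GA f)).
  + rewrite (lin0 (amul_linl Y)) (lin0 (twist_linear a)).
    by rewrite (lin0 (form_lin_second h X _)) mul0r.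
  + move=> e u v hu hv; rewrite amul_linl twist_linear (form_lin_second h X _) hu hv.
    by rewrite mulrDl scalerAl.
  move=> b g hg; rewrite (twist_amul _ _ hg) (linZ _ _ (form_lin_second h X _)).
  by rewrite (form_amul_second h _ _ hX hg) scalerA cocycleVM scale1r.
- move=> s1 s2 b d Y Z hY hZ; rewrite !map_cat /= (twist_hom a hY) (twist_hom a hZ).
  have L t1 t2 : linear (fun X => alpha (t1 ++ X :: t2)) := form_lin_at h t1 t2.
  have E Y' Z' e e' : alpha (X :: map (twist a) s1 ++ e *: Y' :: e' *: Z' :: map (twist a) s2)
    = (e * e') *: alpha (X :: map (twist a) s1 ++ Y' :: Z' :: map (twist a) s2).
    rewrite (linZ _ _ (L (X :: map (twist a) s1) (e' *: Z' :: map (twist a) s2))).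
    have := linZ e' Z' (L (X :: map (twist a) s1 ++ [:: Y']) (map (twist a) s2)).
    by rewrite /= -!catA /= => ->; rewrite scalerA.
  rewrite !E (form_swap h (X :: map (twist a) s1) _ hY hZ) !scalerA.
  by congr (_ *: _); rewrite mulrC (mulrC (rho b a)).
move=> s ss hs; pose s' := (a, X) :: [seq (x.1, twist a x.2) | x <- s].
have := form_deg h (s := s'); rewrite /= size_map ss => /(_ erefl).
rewrite big_cons big_map /= addrA -!map_comp; apply=> x.
rewrite inE => /orP[/eqP->//|/mapP[y ys ->]] /=.
rewrite (twist_hom a (hs _ ys)); exact: (homZ rder_grading) (hs _ ys).
Qed.

Lemma interior1_span a X alpha : rder_hom a X -> hspan form_raw_hom alpha ->
  hspan form_raw_hom (interior1 a X alpha).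
Proof.
move=> hX; elim=> [|[n c] e al be hal _ IH].
  by rewrite (_ : interior1 _ _ _ = 0) //; apply: hspan_zero.
rewrite (_ : interior1 _ _ _ = e *: interior1 a X al + interior1 a X be) //.
apply: hspan_linear => //; case: n hal => [[|p]|n] /= hal; last 1 first.
- by rewrite hal; apply: hspan_zero.
- rewrite (_ : interior1 a X al = 0); first exact: hspan_zero.
  by apply/funext => s; rewrite /interior1 (form_size hal).
apply: (@hspan_hom _ _ _ _ (p%:Z, c + a)).
exact: interior1_form hX hal.
Qed.

Lemma form_lin_slot (alpha : dform) s1 s2 : linear (fun X => alpha (s1 ++ X :: s2)).
Proof.
rewrite /form_fun; elim: (dsumP alpha) => [|[[p|n] a] e al be /= hal _ IH] c X Y.
- by rewrite /= scaler0 addr0.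
- rewrite !fctE (form_linear hal) IH !scalerDr !scalerA (mulrC e) -!addrA.
  by congr (_ + _); rewrite addrCA.
by rewrite hal scaler0 add0r IH.
Qed.

Lemma interior_rawE (alpha : dform) a X : rder_hom a X ->
  interior_raw X alpha = interior1 a X alpha.
Proof.
move=> hX; apply/funext => s; rewrite /interior_raw.
apply: (fsum_hpart_id rder_grading
  (phi := fun b Y => alpha (Y :: map (twist b) s))) hX => b.
exact: (lin0 (form_lin_slot alpha [::] _)).
Qed.

Lemma interior_raw_linl (alpha : dform) c X Y :
  interior_raw (c *: X + Y) alpha = c *: interior_raw X alpha + interior_raw Y alpha.
Proof.
apply/funext => s; apply: (fsum_hpart_linear rder_grading
  (phi := fun a X => alpha (X :: map (twist a) s))) => a.
exact: (form_lin_slot alpha [::]).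
Qed.

Lemma interior_proof (X : rder) (alpha : dform) :
  hspan form_raw_hom (interior_raw X alpha).
Proof.
elim/rder_ind: X => [|c X Y hX hY|a X hX].
- rewrite (_ : interior_raw 0 _ = 0); first exact: hspan_zero.
  have := interior_raw_linl alpha (-1) 0 0.
  by rewrite scaler0 addr0 scaleN1r addNr.
- by rewrite interior_raw_linl; apply: hspan_linear.
rewrite (interior_rawE _ hX); apply: interior1_span => //; exact: dsumP.
Qed.

Definition interior (X : rder) (alpha : dform) : dform :=
  mk_dsum (interior_proof X alpha).

Lemma interior_linr X : linear (interior X).
Proof.
move=> c al be; apply: val_inj => /=; elim/rder_ind: X => [|e X Y hX hY|a X hX].
- have z (ga : dform) : interior_raw 0 ga = 0.
    have := interior_raw_linl ga (-1) 0 0.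
    by rewrite scaler0 addr0 scaleN1r addNr.
  by rewrite !z scaler0 addr0.
- rewrite !interior_raw_linl hX hY !scalerDr !scalerA (mulrC e) -!addrA.
  by congr (_ + _); rewrite addrCA.
by rewrite !(interior_rawE _ hX).
Qed.

Lemma interior_linl alpha : linear (fun X => interior X alpha).
Proof. by move=> c X Y; apply: val_inj; exact: interior_raw_linl. Qed.

Definition const_raw (f : A) (s : seq rder) : A := if s is [::] then f else 0.

Lemma const_raw_hom a f : homA a f -> form_raw_hom (0, a) (const_raw f).
Proof.
move=> hu; split.
- by case.
- by move=> [|? ?] *; rewrite /= scaler0 addr0.
- by move=> *; rewrite /= mulr0.
- by move=> [|? ?] *; rewrite /= scaler0.
by case=> // _ _; rewrite big_nil addr0.
Qed.

Lemma const_proof f : hspan form_raw_hom (const_raw f).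
Proof.
apply: (@hspan_elim A G homA (fun f => hspan form_raw_hom (const_raw f)) _ _ _ f
  (grading_span GA f)).
- rewrite (_ : const_raw 0 = 0); first exact: hspan_zero.
  by apply/funext => -[].
- move=> c u v hu hv; have := hspan_linear c hu hv; congr hspan.
  by apply/funext => -[|? ?]; rewrite !fctE //= scaler0 addr0.
by move=> a u /const_raw_hom; exact: hspan_hom.
Qed.

(* the inclusion of A as the forms of degree 0 *)
Definition const_form (f : A) : dform := mk_dsum (const_proof f).

Definition dfun_raw (f : A) (s : seq rder) : A := if s is [:: X] then X f else 0.

Lemma dfun_raw_hom a f : homA a f -> form_raw_hom (1, a) (dfun_raw f).
Proof.
move=> hu; split.
- by case=> [|X []].
- by move=> [|X [|? ?]] [|Z t] * /=; rewrite ?scaler0 ?addr0.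
- by move=> f' X [|? ?] //=; rewrite mulr0.
- by move=> [|? [|? ?]] *; rewrite /= scaler0.
case=> [|[b X] []] //= _ hs; rewrite big_seq1 /=.
have [[_ hX] _] := hs (b, X) (mem_head _ _).
by rewrite addrC; apply: hX.
Qed.

Lemma dfun_proof f : hspan form_raw_hom (dfun_raw f).
Proof.
apply: (@hspan_elim A G homA (fun f => hspan form_raw_hom (dfun_raw f)) _ _ _ f
  (grading_span GA f)).
- rewrite (_ : dfun_raw 0 = 0); first exact: hspan_zero.
  by apply/funext => -[|X []] //=; exact: (lin0 (rder_linear X)).
- move=> c u v hu hv; have := hspan_linear c hu hv; congr hspan.
  apply/funext => -[|X [|? ?]]; rewrite !fctE //= ?scaler0 ?addr0 //.
  by rewrite rder_linear.
by move=> a u /dfun_raw_hom; exact: hspan_hom.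
Qed.

Definition dfun (f : A) : dform := mk_dsum (dfun_proof f).

(* These properties determine the product: on a sequence [X :: s] the value of
   [wedge alpha beta] is, up to a unit, that of [interior X (wedge alpha beta)]
   on [s], and [wedge_interior] expands the latter in lower degree. *)
Record wedge_product := WedgeProduct {
  wedge :> dform -> dform -> dform;
  wedge_linl : forall beta, linear (fun alpha => wedge alpha beta);
  wedge_linr : forall alpha, linear (wedge alpha);
  wedgeA : associative wedge;
  wedge_hom : forall u v alpha beta, form_hom u alpha -> form_hom v beta ->
    form_hom (u + v) (wedge alpha beta);
  wedge_comm : forall alpha beta, rho_comm rho' form_hom wedge alpha beta = 0;
  wedge_const : forall f g, wedge (const_form f) (const_form g) = const_form (f * g);
  wedge_right : forall alpha f s, wedge alpha (const_form f) s = alpha s * f;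
  wedge_interior : forall a X, rder_hom a X ->
    is_rho_derivation rho' form_hom wedge (-1, a) (interior X) }.

Section DeRham.
Variable W : wedge_product.

Definition Omega01 : set dform :=
  [set omega | exists n (f g : 'I_n -> A),
     omega = \sum_(k < n) W (dfun (f k)) (const_form (g k))].

Inductive in_Omega0 : dform -> Prop :=
| Omega0_const f : in_Omega0 (const_form f)
| Omega0_dfun omega : Omega01 omega -> in_Omega0 omega
| Omega0_linear c alpha beta :
    in_Omega0 alpha -> in_Omega0 beta -> in_Omega0 (c *: alpha + beta)
| Omega0_wedge alpha beta :
    in_Omega0 alpha -> in_Omega0 beta -> in_Omega0 (W alpha beta).

Definition Omega0_pred : {pred dform} := fun omega => `[< in_Omega0 omega >].

Lemma in_Omega0_zero : in_Omega0 0.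
Proof.
rewrite (_ : 0 = const_form 0); first exact: Omega0_const.
by apply: val_inj; apply/funext => -[].
Qed.

Lemma Omega0_closed : subsemimod_closed Omega0_pred.
Proof.
split; first split.
- exact/asboolP/in_Omega0_zero.
- move=> u v /asboolP hu /asboolP hv; apply/asboolP; rewrite -[u]scale1r.
  exact: Omega0_linear.
move=> c u /asboolP hu; apply/asboolP; rewrite -[_ *: _]addr0.
by apply: Omega0_linear => //; apply: in_Omega0_zero.
Qed.

Record Omega0 := MkOmega0 { Omega0_val : dform; _ : Omega0_pred Omega0_val }.
HB.instance Definition _ := [isSub for Omega0_val].
HB.instance Definition _ := [Choice of Omega0 by <:].
HB.instance Definition _ := GRing.SubChoice_isSubLmodule.Build K dform Omega0_pred
  Omega0 Omega0_closed.

Definition mk_Omega0 omega (h : in_Omega0 omega) : Omega0 :=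
  @MkOmega0 omega (asboolT h).

Lemma Omega0P (omega : Omega0) : in_Omega0 (val omega).
Proof. exact/asboolP/(valP omega). Qed.

Definition Omega0_hom (u : bideg) : set Omega0 := [set omega | form_hom u (val omega)].

Definition wedge0 (alpha beta : Omega0) : Omega0 :=
  mk_Omega0 (Omega0_wedge (Omega0P alpha) (Omega0P beta)).

Definition const0 (f : A) : Omega0 := mk_Omega0 (Omega0_const f).

Record is_deRham (d : Omega0 -> Omega0) : Prop := IsDeRham {
  deRham_derivation : is_rho_derivation rho' Omega0_hom wedge0 (1, 0) d;
  deRham_const : forall f, val (d (const0 f)) = dfun f;
  deRham_square : forall omega, d (d omega) = 0 }.

Inductive hom_sum (P : dform -> Prop) : dform -> Prop :=
| hom_sum0 : hom_sum P 0
| hom_sum_cons c u alpha beta : form_hom u alpha -> P alpha -> hom_sum P beta ->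
    hom_sum P (c *: alpha + beta).

Lemma hom_sum_lin P c alpha beta :
  hom_sum P alpha -> hom_sum P beta -> hom_sum P (c *: alpha + beta).
Proof.
move=> hu hv; elim: hu => [|e u x y hx px _ IH]; first by rewrite scaler0 add0r.
by rewrite scalerDr scalerA -addrA; apply: hom_sum_cons hx px IH.
Qed.

Lemma hom_sum1 (P : dform -> Prop) u alpha : form_hom u alpha -> P alpha -> hom_sum P alpha.
Proof.
move=> hu pu; rewrite -[alpha]scale1r -[_ *: _]addr0.
exact: hom_sum_cons hu pu (hom_sum0 _).
Qed.

Lemma const_hom a f : homA a f -> form_hom (0, a) (const_form f).
Proof. exact: const_raw_hom. Qed.

Lemma const_linear : linear const_form.
Proof.
by move=> c u v; apply: val_inj; apply/funext => -[|? ?]; rewrite /= !fctE //= scaler0 addr0.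
Qed.

Lemma dfun_hom a f : homA a f -> form_hom (1, a) (dfun f).
Proof. exact: dfun_raw_hom. Qed.

Lemma dfun_linear : linear dfun.
Proof.
move=> c u v; apply: val_inj; apply/funext => -[|X [|? ?]];
  by rewrite /= !fctE //= ?scaler0 ?addr0 // rder_linear.
Qed.

Lemma interior_const X f : interior X (const_form f) = 0.
Proof.
by apply: val_inj; apply/funext => s /=; rewrite /interior_raw fsbig1.
Qed.

Lemma interior_dfun X f : interior X (dfun f) = const_form (X f).
Proof.
elim/rder_ind: X => [|c X Y hX hY|a X hX].
- rewrite (lin0 (interior_linl _)) (_ : rder_fun 0 f = 0) //.
  by rewrite (lin0 const_linear).
- by rewrite interior_linl hX hY -const_linear.
apply: val_inj => /=; rewrite (interior_rawE _ hX).
by apply/funext => -[|? ?]; rewrite /interior1.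
Qed.

Lemma dfun_hom_sum (P : dform -> Prop) :
  (forall a b f g, homA a f -> homA b g -> P (W (dfun f) (const_form g))) ->
  forall f g, hom_sum P (W (dfun f) (const_form g)).
Proof.
move=> h f g.
apply: (@hspan_elim A G homA (fun f => hom_sum P (W (dfun f) (const_form g))) _ _ _ f
  (grading_span GA f)).
- by rewrite (lin0 dfun_linear) (lin0 (wedge_linl W _)); exact: hom_sum0.
- by move=> c u v hu hv; rewrite dfun_linear wedge_linl; apply: hom_sum_lin.
move=> a {}f hf.
apply: (@hspan_elim A G homA (fun g => hom_sum P (W (dfun f) (const_form g))) _ _ _ g
  (grading_span GA g)).
- by rewrite (lin0 const_linear) (lin0 (wedge_linr W _)); exact: hom_sum0.
- by move=> c u v hu hv; rewrite const_linear wedge_linr; apply: hom_sum_lin.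
move=> b {}g hg; apply: (@hom_sum1 _ ((1, a) + (0, b))); last exact: h hf hg.
by apply: wedge_hom; [exact: dfun_hom|exact: const_hom].
Qed.

Lemma interior_Omega0 X omega : in_Omega0 omega -> in_Omega0 (interior X omega).
Proof.
elim/rder_ind: X => [|c X Y hX hY|b X hX] ho.
- by rewrite (lin0 (interior_linl _)); exact: in_Omega0_zero.
- by rewrite interior_linl; apply: Omega0_linear; [exact: hX|exact: hY].
have [_ dX] := wedge_interior W hX.
pose P al := in_Omega0 al /\ in_Omega0 (interior X al).
have E0 f g : in_Omega0 (W (dfun f) (const_form g)).
  apply: Omega0_dfun; exists 1%N, (fun=> f), (fun=> g); by rewrite big_ord1.
suff : hom_sum P omega.
  elim=> [|c u al be hal [_ pal] _ IH].
    by rewrite (lin0 (interior_linr X)); exact: in_Omega0_zero.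
  by rewrite interior_linr; apply: Omega0_linear.
elim: ho => {omega} [f|omega [n [f [g ->]]]|c al be _ hal _ hbe|al be _ hal _ hbe].
- apply: (@hspan_elim A G homA (fun f => hom_sum P (const_form f)) _ _ _ f (grading_span GA f)).
  + by rewrite (lin0 const_linear); exact: hom_sum0.
  + by move=> c u v hu hv; rewrite const_linear; apply: hom_sum_lin.
  move=> a u hu; apply: (hom_sum1 (const_hom hu)); split; first exact: Omega0_const.
  by rewrite interior_const; exact: in_Omega0_zero.
- elim: n f g => [|n IH] f g; first by rewrite big_ord0; exact: hom_sum0.
  rewrite big_ord_recl -[W _ _]scale1r; apply: hom_sum_lin; last exact: IH.
  apply: dfun_hom_sum => a a' {}f {}g hf hg; split; first exact: E0.
  rewrite (dX _ _ _ (dfun_hom hf)) interior_const interior_dfun.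
  rewrite (lin0 (wedge_linr W _)) scaler0 addr0 wedge_const; exact: Omega0_const.
- exact: hom_sum_lin.
elim: hal => [|c u al' al'' h1 [p1 q1] _ IH].
  by rewrite (lin0 (wedge_linl W _)); exact: hom_sum0.
rewrite wedge_linl; apply: hom_sum_lin => //.
elim: hbe {IH} => [|c' v be' be'' h2 [p2 q2] _ IH].
  by rewrite (lin0 (wedge_linr W _)); exact: hom_sum0.
rewrite wedge_linr; apply: hom_sum_lin => //.
apply: (hom_sum1 (wedge_hom W h1 h2)); split; first exact: Omega0_wedge.
rewrite (dX _ _ _ h1) addrC; apply: Omega0_linear; exact: Omega0_wedge.
Qed.

Definition interior0 (X : rder) (omega : Omega0) : Omega0 :=
  mk_Omega0 (interior_Omega0 X (Omega0P omega)).

Definition section_raw_hom (u : bideg) : set (Omega0 -> Omega0) :=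
  [set F | u.1 < 0 /\ is_rho_derivation rho' Omega0_hom wedge0 u F].

Definition sections : Type := dsum section_raw_hom.
Definition section_fun (F : sections) : Omega0 -> Omega0 := val F.
Coercion section_fun : sections >-> Funclass.

Lemma interior0_proof X : hspan section_raw_hom (interior0 X).
Proof.
elim/rder_ind: X => [|c X Y hX hY|a X hX].
- rewrite (_ : interior0 0 = 0); first exact: hspan_zero.
  apply/funext => al; apply: val_inj => /=; exact: (lin0 (interior_linl _)).
- rewrite (_ : interior0 _ = c *: interior0 X + interior0 Y); first exact: hspan_linear.
  by apply/funext => al; apply: val_inj => /=; exact: interior_linl.
apply: (@hspan_hom _ _ _ _ (-1, a)); split=> //.
have [[_ hh] dX] := wedge_interior W hX.
split; first split.
- by move=> c al be; apply: val_inj; exact: interior_linr.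
- by move=> i al; apply: hh.
by move=> i al be hal; apply: val_inj; exact: dX hal.
Qed.

Definition i_ (X : rder) : sections := mk_dsum (interior0_proof X).

Definition map_comm (F H : Omega0 -> Omega0) : Omega0 -> Omega0 :=
  rho_comm rho' (hom_map Omega0_hom) (fun F H => F \o H) F H.

Definition derived_bracket (d F H : Omega0 -> Omega0) : Omega0 -> Omega0 :=
  map_comm (map_comm d F) H.

End DeRham.

End OneAlgebra.
End Forms.

(* Main.v *)
Require Import Defs.
From mathcomp Require Import all_boot all_algebra.
From mathcomp Require Import boolp classical_sets functions cardinality fsbigop.

Set Implicit Arguments.
Unset Strict Implicit.
Unset Printing Implicit Defensive.

Import GRing.Theory.
Local Open Scope classical_set_scope.
Local Open Scope ring_scope.

(** Cartan calculus. The commutator [L_X = [d, i_X]] equals [d i_X + i_X d] for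
    a homogeneous derivation [X], so it sends [f] to [X f] and [df] to
    [d (X f)]. Therefore [[L_X, i_Y]] kills functions and sends [df] to
    [X (Y f) - rho(|X|,|Y|) Y (X f)], which is what the interior derivative
    along the bracket of [X] and [Y] does. Both sides are derivations of the
    same degree ([rho_derivation_comm], [interior0_derivation]), and a
    derivation of the algebra generated by functions and their differentials is
    determined by its values on these generators ([rho_derivation_eq]). This
    settles homogeneous [X] and [Y]; the general case follows because both sides
    are bilinear in [X] and [Y].

    The commutator of two operators is defined through their homogeneous
    components, although the space of all operators is not graded. So
    bilinearity, and the usual formula on homogeneous operators, rest on two
    facts. Homogeneous maps of distinct degrees are linearly independent
    ([hom_map_independent]), which makes components unique; for this the forms
    must be graded ([form_independent], [Omega0_grading]). And a commutator
    computed in the span of an independent family is the commutator of a genuine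
    graded space ([rho_comm_dsum]). *)

(** * Graded spaces and their commutators *)

Section GradedSpaces.
Context {K : fieldType} {I : zmodType}.

Definition subspace_family (V : lmodType K) (hom : I -> set V) : Prop :=
  (forall i, hom i 0) /\
  (forall i c u v, hom i u -> hom i v -> hom i (c *: u + v)).

Definition independent (V : lmodType K) (hom : I -> set V) : Prop :=
  forall (w : I -> V) (s : seq I), uniq s -> (forall i, hom i (w i)) ->
    \sum_(i <- s) w i = 0 -> forall i, i \in s -> w i = 0.

Lemma linear_eq_hom (V W : lmodType K) (hom : I -> set V) (F H : V -> W) :
  (forall v, hspan hom v) -> linear F -> linear H ->
  (forall i v, hom i v -> F v = H v) -> F =1 H.
Proof.
move=> sp lF lH E v.
apply: (@hspan_elim K V I hom (fun v => F v = H v) _ _ _ v (sp v)).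
- by rewrite (lin0 lF) (lin0 lH).
- by move=> c x y ex ey; rewrite lF lH ex ey.
exact: E.
Qed.

Lemma fsum_linear (V W : lmodType K) (S : set I) (phi : I -> V -> W) :
  finite_set S -> (forall i, linear (phi i)) ->
  (forall i v, ~ S i -> phi i v = 0) ->
  linear (fun v => \sum_(i \in [set: I]) phi i v).
Proof.
move=> /(@finite_fsum K)[s [_ out _ E]] lphi p0 c u v.
have vanish v' i : i \notin s -> phi i v' = 0 by move=> /out; apply: p0.
rewrite (E _ _ (vanish _)) (E _ _ (vanish u)) (E _ _ (vanish v)).
rewrite scaler_sumr -big_split /=; apply: eq_bigr => i _; exact: lphi.
Qed.

Lemma lin_fsum (V W : lmodType K) (F : V -> W) (w : I -> V) :
  linear F -> finite_set [set i | w i != 0] ->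
  F (\sum_(i \in [set: I]) w i) = \sum_(i \in [set: I]) F (w i).
Proof.
move=> lF /(@finite_fsum K)[s [_ out _ E]].
have w0 i : i \notin s -> w i = 0 by move=> /out/negP/negPn/eqP.
by rewrite !E ?(lin_sum _ _ lF) // => i /w0 ->; rewrite (lin0 lF).
Qed.

Lemma grading_independent (V : lmodType K) (hom : I -> set V) :
  is_grading hom -> independent hom.
Proof.
move=> GV w s us hw e i si.
have lp : linear (fun v => hpart hom v i) by move=> c u v; rewrite hpart_linear.
rewrite -(hpart0 GV i) -e (lin_sum s w lp) (bigD1_seq i) //= (hpart_id GV (hw i)) eqxx.
rewrite big1 ?addr0 // => j ji.
by rewrite (hpart_id GV (hw j)) eq_sym (negPf ji).
Qed.

Section Dsum.
Variables (V : lmodType K) (hom : I -> set V).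

Lemma dsum_span (x : dsum hom) : hspan (dhom (hom := hom)) x.
Proof.
case: x => v hv; have := hv; move/asboolP => sv; move: hv.
elim: sv => [|i c u v' hu sv IH] hv.
  by rewrite (_ : DSum hv = 0); [apply: hspan_zero|apply: val_inj].
rewrite (_ : DSum hv = c *: mk_dsum (hspan_hom hu) + mk_dsum sv); last exact: val_inj.
by apply: (hspan_cons (i := i)) => //; apply: IH.
Qed.

Hypotheses (homS : subspace_family hom) (homI : independent hom).

(** This makes the theory of graded spaces available for the span of a family
    inside a space that is not itself graded. *)
Lemma dsum_grading : is_grading (dhom (hom := hom)).
Proof.
have [h0 hl] := homS; apply: gradingI.
- exact: h0.
- by move=> i c u v; apply: hl.
- exact: dsum_span.
move=> w s us hw e i si; apply: val_inj.
apply: (homI us (w := fun j => val (w j)) hw _ si).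
by rewrite -(lin_sum (F := val) s w) ?e.
Qed.

(** A decomposition in the ambient space consists of homogeneous vectors, which
    lie in the span; so it lifts to the span, where it is unique. *)
Lemma hpart_dsum (x : dsum hom) :
  hpart hom (val x) = fun i => val (hpart (dhom (hom := hom)) x i).
Proof.
have lval : linear (val : dsum hom -> V) by [].
have [fx hx ex] := hpartP dsum_grading x.
have : is_decomp hom (val x) (hpart hom (val x)).
  rewrite /hpart; apply: xgetPex.
  exists (fun i => val (hpart (dhom (hom := hom)) x i)); split=> //.
  by rewrite {1}ex (lin_fsum lval fx).
move=> [fw hw ew]; set w := hpart hom (val x) in fw hw ew *.
pose w' i : dsum hom := mk_dsum (hspan_hom (hw i)).
have fw' : finite_set [set i | w' i != 0] := fw.
have dx : is_decomp (dhom (hom := hom)) x w'.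
  by split=> //; apply: val_inj; rewrite (lin_fsum lval fw').
by rewrite (hpart_uniq dsum_grading dx).
Qed.

End Dsum.

Section RhoCommutator.
Variables (rho : I -> I -> K) (V W : lmodType K) (hom : I -> set V) (mul : V -> V -> W).
Hypotheses (GV : is_grading hom).
Hypotheses (mull : forall v, linear (mul^~ v)) (mulr : forall u, linear (mul u)).

Lemma rho_comm_term_linl i j v :
  linear (fun u => mul u v - rho i j *: mul v u).
Proof.
move=> c x y; rewrite mull mulr scalerBr scalerDr opprD !scalerA (mulrC c).
by rewrite addrACA.
Qed.

Lemma rho_comm_term_linr i j u :
  linear (fun v => mul u v - rho i j *: mul v u).
Proof.
move=> c x y; rewrite mull mulr scalerBr scalerDr opprD !scalerA (mulrC c).
by rewrite addrACA.
Qed.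

Lemma rho_comm_linl v : linear (fun u => rho_comm rho hom mul u v).
Proof.
have [fv _ _] := hpartP GV v.
apply: (fsum_hpart_linear GV (phi := fun i u => \sum_(j \in [set: I])
  (mul u (hpart hom v j) - rho i j *: mul (hpart hom v j) u))) => i.
apply: (fsum_linear fv) => [j|j u]; first exact: rho_comm_term_linl.
by move=> /negP/negPn/eqP ->; rewrite (lin0 (mulr u)) (lin0 (mull u)) scaler0 subr0.
Qed.

Lemma rho_comm_linr u : linear (rho_comm rho hom mul u).
Proof.
have [fu _ _] := hpartP GV u.
apply: (fsum_linear (phi := fun i v => \sum_(j \in [set: I])
  (mul (hpart hom u i) (hpart hom v j) - rho i j *: mul (hpart hom v j) (hpart hom u i)))
  fu) => [i|i v].
  apply: (fsum_hpart_linear GV (phi := fun j v =>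
    mul (hpart hom u i) v - rho i j *: mul v (hpart hom u i))) => j.
  exact: rho_comm_term_linr.
move=> /negP/negPn/eqP ->; rewrite fsbig1 // => j _.
by rewrite (lin0 (mulr _)) (lin0 (mull _)) scaler0 subr0.
Qed.

Lemma rho_comm_hom a b u v : hom a u -> hom b v ->
  rho_comm rho hom mul u v = mul u v - rho a b *: mul v u.
Proof.
move=> hu hv; rewrite /rho_comm.
rewrite (fsum_hpart_id GV (phi := fun i u => \sum_(j \in [set: I])
  (mul u (hpart hom v j) - rho i j *: mul (hpart hom v j) u)) _ hu).
  rewrite (fsum_hpart_id GV (phi := fun j v => mul u v - rho a j *: mul v u) _ hv) //.
  by move=> j; apply: (lin0 (rho_comm_term_linr a j u)).
move=> i; rewrite fsbig1 // => j _.
exact: (lin0 (rho_comm_term_linl i j _)).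
Qed.

End RhoCommutator.

Lemma rho_comm_dsum (rho : I -> I -> K) (V W : lmodType K) (hom : I -> set V)
    (mul : V -> V -> W) (x y : dsum hom) :
  subspace_family hom -> independent hom ->
  rho_comm rho hom mul (val x) (val y) =
  rho_comm rho (dhom (hom := hom)) (fun x y => mul (val x) (val y)) x y.
Proof. by move=> hS hI; rewrite /rho_comm !hpart_dsum. Qed.

Section LinearMaps.
Variables (V : lmodType K) (hom : I -> set V).
Hypothesis GV : is_grading hom.

Lemma hom_map_subspace : subspace_family (hom_map hom).
Proof.
split=> [u|u c F H [lF hF] [lH hH]].
  split=> [c x y|i x _]; last exact: (hom0 GV).
  by rewrite /= scaler0 addr0.
split=> [e x y|i x hx]; last by apply: (hom_lin GV); [apply: hF|apply: hH].
rewrite !fctE /= lF lH !scalerDr !scalerA (mulrC e) -!addrA; congr (_ + _).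
by rewrite addrCA.
Qed.

(** Evaluate a vanishing sum on a homogeneous vector: maps of distinct degrees
    take it to distinct degrees, so each value vanishes, and homogeneous vectors
    span. *)
Lemma hom_map_independent : independent (hom_map hom).
Proof.
move=> w s us hw e u su; apply/funext.
apply: (@linear_eq_hom V V hom (w u) 0); first exact: (grading_span GV).
- by case: (hw u).
- by move=> c x y; rewrite /= scaler0 addr0.
move=> i x hx.
have hwx k : hom k (w (k - i) x).
  by case: (hw (k - i)) => _ /(_ i x hx); rewrite subrK.
have := grading_independent GV (s := [seq v + i | v <- s]) _ hwx.
rewrite map_inj_uniq; last exact: addIr.
move=> /(_ us _ (u + i)); rewrite big_map addrK; apply; last exact: map_f.
under eq_bigr do rewrite addrK.
have ev (t : seq I) : \sum_(v <- t) w v x = (\sum_(v <- t) w v) x.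
  by elim: t => [|v t IH]; rewrite ?big_nil ?big_cons //= IH.
by rewrite ev e.
Qed.

Lemma hom_map_comp u v F H : hom_map hom u F -> hom_map hom v H ->
  hom_map hom (u + v) (F \o H).
Proof.
move=> [lF hF] [lH hH]; split=> [c x y|i x hx] /=; first by rewrite lH lF.
by rewrite -addrA; apply: hF; apply: hH.
Qed.

Lemma hspan_hom_map_linear F : hspan (hom_map hom) F -> linear F.
Proof.
apply: hspan_elim => [c x y|c {}F H lF lH e x y|u {}F [] //].
  by rewrite /= scaler0 addr0.
rewrite !fctE /= lF lH !scalerDr !scalerA (mulrC e) -!addrA; congr (_ + _).
by rewrite addrCA.
Qed.

Variable rho : I -> I -> K.

(* Composition is linear in its right argument only when the left one is a linear
   map, so bilinearity holds on the span D and not on all of V -> V. *)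
Let comm (F H : V -> V) := rho_comm rho (hom_map hom) (fun F H => F \o H) F H.
Let D := dsum (hom_map hom).
Let GD : is_grading (dhom (hom := hom_map hom)) :=
  dsum_grading hom_map_subspace hom_map_independent.
Let mul (x y : D) : V -> V := val x \o val y.

Let mul_linl y : linear (mul^~ y).
Proof. by []. Qed.

Let mul_linr x : linear (mul x).
Proof.
move=> c y z; apply/funext => v.
exact: (hspan_hom_map_linear (dsumP x) c (val y v) (val z v)).
Qed.

Let comm_dsum (x y : D) : comm (val x) (val y) = rho_comm rho (dhom (hom := hom_map hom)) mul x y.
Proof. exact: rho_comm_dsum hom_map_subspace hom_map_independent. Qed.

Lemma rho_comm_map_linl c F F' H : hspan (hom_map hom) F -> hspan (hom_map hom) F' ->
  hspan (hom_map hom) H -> comm (c *: F + F') H = c *: comm F H + comm F' H.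
Proof.
move=> sF sF' sH.
have E x : comm (val x) H = rho_comm rho _ mul x (mk_dsum sH) := comm_dsum x (mk_dsum sH).
rewrite (E (c *: mk_dsum sF + mk_dsum sF')) (E (mk_dsum sF)) (E (mk_dsum sF')).
exact: (rho_comm_linl rho GD mul_linl mul_linr).
Qed.

Lemma rho_comm_map_linr c F H H' : hspan (hom_map hom) F -> hspan (hom_map hom) H ->
  hspan (hom_map hom) H' -> comm F (c *: H + H') = c *: comm F H + comm F H'.
Proof.
move=> sF sH sH'.
have E y : comm F (val y) = rho_comm rho _ mul (mk_dsum sF) y := comm_dsum (mk_dsum sF) y.
rewrite (E (c *: mk_dsum sH + mk_dsum sH')) (E (mk_dsum sH)) (E (mk_dsum sH')).
exact: (rho_comm_linr rho GD mul_linl mul_linr).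
Qed.

Lemma rho_comm_map_hom u v F H : hom_map hom u F -> hom_map hom v H ->
  comm F H = F \o H - rho u v *: (H \o F).
Proof.
move=> hF hH.
rewrite (comm_dsum (mk_dsum (hspan_hom hF)) (mk_dsum (hspan_hom hH))).
exact: (rho_comm_hom rho GD mul_linl mul_linr).
Qed.

End LinearMaps.

(** In both compositions the Leibniz rule produces the mixed terms
    [(E f)(D g)] and [(D f)(E g)]; the factor [rho u v] is chosen to cancel them. *)
Lemma rho_derivation_comm (rho : cocycle K I) (V : lmodType K) (hom : I -> set V)
    (mul : V -> V -> V) u v D E :
  is_grading hom -> (forall y, linear (mul^~ y)) -> (forall x, linear (mul x)) ->
  is_rho_derivation rho hom mul u D -> is_rho_derivation rho hom mul v E ->
  is_rho_derivation rho hom mul (u + v) (D \o E - rho u v *: (E \o D)).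
Proof.
move=> GV mull mulr [hmD dD] [hmE dE]; split.
  rewrite [X in hom_map _ _ X]addrC -scaleNr; apply: (hom_map_subspace GV).2.
    by rewrite [u + v]addrC; apply: hom_map_comp.
  exact: hom_map_comp.
have [[lD hD] [lE hE]] := (hmD, hmE).
move=> i f g hf; rewrite !fctE /= (dE i) // (dD i) //.
rewrite (linD _ _ lD) (linD _ _ lE) (linZ _ _ lD) (linZ _ _ lE).
rewrite (dD _ _ _ (hE _ _ hf)) (dD _ _ _ hf) (dE _ _ _ (hD _ _ hf)) (dE _ _ _ hf).
have mulB x y z : mul (x - y) z = mul x z - mul y z.
  by rewrite -scaleN1r addrC mull scaleN1r addrC.
have mulrB x y z : mul x (y - z) = mul x y - mul x z.
  by rewrite -scaleN1r addrC mulr scaleN1r addrC.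
rewrite mulB mulrB !(linZ _ _ (mull _)) !(linZ _ _ (mulr _)) scalerBr.
rewrite !scalerDr !scalerA !cocycleDr !cocycleD.
(* the mixed term r gets equal coefficients since rho u v and rho v u are inverse *)
rewrite mulrA cocycleVM mul1r.
set p := mul (D (E f)) g; set q := mul (E f) (D g); set r := mul (D f) (E g).
set t := mul f _; set p' := mul _ g; set t' := mul f _.
rewrite !opprD; set q1 := _ *: q; set r1 := _ *: r.
rewrite (addrACA p) (addrACA (p + r1)) (addrACA p r1) (addrACA q1) !subrr addr0 add0r.
by rewrite (mulrC (rho v i)) -mulrA [rho u v * _]mulrC.
Qed.

End GradedSpaces.

(** * The grading of differential forms *)

Section Forms.
Context {K : fieldType} {G : zmodType} {rho : cocycle K G}.

Let sgr (m : int) : K := (-1) ^ m.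

Let sgr_neq0 m : sgr m != 0.
Proof. by rewrite expfz_neq0 // oppr_eq0 oner_eq0. Qed.

Let sgrV m : (sgr m)^-1 = sgr m.
Proof. by rewrite /sgr invr_expz -exprz_inv invrN1. Qed.

Lemma rho'_neq0 (u v : int * G) : rho' (rho := rho) u v != 0.
Proof. by rewrite mulf_neq0 ?sgr_neq0 ?cocycle_neq0. Qed.

Lemma rho'V (u v : int * G) : rho' (rho := rho) u v = (rho' (rho := rho) v u)^-1.
Proof. by rewrite /rho' invfM -/(sgr _) -/(sgr _) sgrV -cocycleV (mulrC v.1). Qed.

Lemma rho'D (u v w : int * G) :
  rho' (rho := rho) (u + v) w = rho' (rho := rho) u w * rho' (rho := rho) v w.
Proof.
rewrite /rho' /= mulrDl cocycleD expfzDr ?oppr_eq0 ?oner_eq0 //.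
by rewrite mulrACA.
Qed.

Definition rho'_cocycle : cocycle K (int * G)%type :=
  Cocycle rho'_neq0 rho'V rho'D.

Variable A : acAlgebra rho.

(** By multilinearity the arguments can be made homogeneous one at a time. *)
Lemma form_eq0 p a (alpha : seq (rder A) -> A) : is_form p a alpha ->
  (forall s : seq (G * rder A), size s = p ->
     (forall x, x \in s -> rder_hom x.1 x.2) -> alpha [seq x.2 | x <- s] = 0) ->
  forall s, alpha s = 0.
Proof.
move=> h h0 t; have [st|/(form_size h)//] := eqVneq (size t) p.
suff aux : forall (s : seq (G * rder A)), (size s + size t)%N = p ->
    (forall x, x \in s -> rder_hom x.1 x.2) -> alpha ([seq x.2 | x <- s] ++ t) = 0.
  by apply: (aux [::]).
elim: {st} t => [|X t IH] s ss hs; first by rewrite cats0 h0 // -ss addn0.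
have lz : linear (fun _ : rder A => 0 : A) by move=> c u v; rewrite scaler0 addr0.
apply: (linear_eq_hom (grading_span (rder_grading A)) (form_lin_at h _ t) lz) => b Y hY.
rewrite -cat_rcons -(map_rcons snd s (b, Y)).
apply: IH => [|x]; first by rewrite size_rcons addSnnS.
by rewrite mem_rcons inE => /orP[/eqP->|/hs].
Qed.

(** On a sequence of [p] homogeneous derivations the forms of degree other than
    [p] vanish, and those of degree [p] and distinct [G]-degrees take values in
    distinct degrees of the algebra. *)
Lemma form_independent : independent (@form_hom K G rho A).
Proof.
move=> w s us hw e [n a] su; apply: val_inj.
have := hw (n, a); rewrite /form_hom /dhom /=; case: n su => [p|n] su //= hwu.
apply/funext => t; apply: (form_eq0 hwu) => {t} t st ht.
set c := \sum_(x <- t) x.1; set T := [seq x.2 | x <- t].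
pose z k := form_fun (w (p%:Z, k - c)) T.
have hz k : ac_hom k (z k).
  have := form_deg (hw (p%:Z, k - c)) st ht; by rewrite /= subrK.
have sT v : v.1 != p%:Z -> form_fun (w v) T = 0.
  move: (hw v); rewrite /form_hom /dhom /form_fun /=.
  case: v => [[q|q] b] /= h np; last by rewrite h.
  by apply: (form_size h); rewrite size_map st eq_sym.
have eT (r : seq (int * G)) : \sum_(v <- r) form_fun (w v) T = form_fun (\sum_(v <- r) w v) T.
  by elim: r => [|v r IH]; rewrite ?big_nil ?big_cons //= IH.
have := grading_independent (ac_grading A)
  (s := [seq v.2 + c | v <- s & v.1 == p%:Z]) _ hz _ (i := a + c).
rewrite /z addrK; apply.
- rewrite map_inj_in_uniq ?filter_uniq // => -[m b] [m' b'].
  by rewrite !mem_filter /= => /andP[/eqP-> _] /andP[/eqP-> _] /addIr ->.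
- rewrite big_map big_filter [LHS](_ : _ = \sum_(v <- s) form_fun (w v) T); last first.
    rewrite [RHS](bigID (fun v => v.1 == p%:Z)) /= [X in _ + X]big1; last exact: sT.
    by rewrite addr0; apply: eq_bigr => -[m b] /= /eqP ->; rewrite addrK.
  by rewrite eT e.
by apply/mapP; exists (p%:Z, a) => //; rewrite mem_filter eqxx.
Qed.

Variable W : wedge_product A.

(** Induction on the generated algebra through homogeneous elements, as needed
    for the Leibniz rule, which is stated for a homogeneous left factor. *)
Lemma Omega0_hom_sum (P : dform A -> Prop) :
  (forall a f, ac_hom a f -> P (const_form f)) ->
  (forall a b f g, ac_hom a f -> ac_hom b g -> P (W (dfun f) (const_form g))) ->
  (forall u v alpha beta, form_hom u alpha -> form_hom v beta ->
     P alpha -> P beta -> P (W alpha beta)) ->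
  forall omega, in_Omega0 W omega -> hom_sum P omega.
Proof.
move=> Pc Pd Pw omega; elim=> {omega} [f|omega [n [f [g ->]]]|c al be _ hal _ hbe|al be _ hal _ hbe].
- apply: (@hspan_elim K A G (@ac_hom K G rho A) (fun f => hom_sum P (const_form f)) _ _ _ f
    (grading_span (ac_grading A) f)).
  + by rewrite (lin0 (@const_linear _ _ _ A)); exact: hom_sum0.
  + by move=> c u v hu hv; rewrite const_linear; apply: hom_sum_lin.
  by move=> a u hu; apply: (hom_sum1 (const_hom hu)); exact: Pc hu.
- elim: n f g => [|n IH] f g; first by rewrite big_ord0; exact: hom_sum0.
  rewrite big_ord_recl -[W _ _]scale1r; apply: hom_sum_lin; last exact: IH.
  by apply: dfun_hom_sum.
- exact: hom_sum_lin.
elim: hal => [|c u al' al'' h1 p1 _ IH].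
  by rewrite (lin0 (wedge_linl W _)); exact: hom_sum0.
rewrite wedge_linl; apply: hom_sum_lin => //.
elim: hbe {IH} => [|c' v be' be'' h2 p2 _ IH].
  by rewrite (lin0 (wedge_linr W _)); exact: hom_sum0.
rewrite wedge_linr; apply: hom_sum_lin => //.
by apply: (hom_sum1 (wedge_hom W h1 h2)); apply: Pw h1 h2 p1 p2.
Qed.

Lemma in_Omega0_dfun f g : in_Omega0 W (W (dfun f) (const_form g)).
Proof. by apply: Omega0_dfun; exists 1%N, (fun=> f), (fun=> g); rewrite big_ord1. Qed.

Lemma form_subspace : subspace_family (@form_hom K G rho A).
Proof.
split=> [[[p|n] a]|[[p|n] a] c al be] //; rewrite /form_hom /dhom /=.
- split=> //.
  + by move=> *; rewrite /= scaler0 addr0.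
  + by move=> *; rewrite /= mulr0.
  + by move=> *; rewrite /= scaler0.
  by move=> *; apply: (hom0 (ac_grading A)).
- move=> hal hbe; split.
  + by move=> s hs; rewrite !fctE (form_size hal) // (form_size hbe) // scaler0 addr0.
  + move=> s1 s2 e X Y; rewrite !fctE (form_linear hal) (form_linear hbe).
    by rewrite !scalerDr !scalerA (mulrC e) addrACA.
  + move=> f X s; rewrite !fctE (form_amul hal) (form_amul hbe).
    by rewrite mulrDr scalerAr.
  + move=> s1 s2 b b' X Y hX hY; rewrite !fctE (form_swap hal _ _ hX hY).
    by rewrite (form_swap hbe _ _ hX hY) scalerDr !scalerA (mulrC c).
  move=> s hs hx; rewrite !fctE; apply: (hom_lin (ac_grading A)).
    exact: (form_deg hal).
  exact: (form_deg hbe).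
by move=> -> ->; rewrite scaler0 addr0.
Qed.

Lemma Omega0_grading : is_grading (@Omega0_hom K G rho A W).
Proof.
have [h0 hl] := form_subspace; apply: gradingI.
- by move=> u; apply: (h0 u).
- by move=> u c al be; apply: hl.
- move=> omega; have := Omega0P omega; move eal: (val omega) => al hal.
  have : hom_sum (in_Omega0 W) al.
    apply: Omega0_hom_sum hal => [a f _|a b f g _ _|u v x y _ _].
    - exact: Omega0_const.
    - exact: in_Omega0_dfun.
    exact: Omega0_wedge.
  move=> hs; elim: hs omega eal => [|c u x y hx px hy IH] omega eo.
    by rewrite (_ : omega = 0); [apply: hspan_zero|apply: val_inj].
  have py : in_Omega0 W y.
    elim: {IH eo} hy => [|e v x' y' _ px' _ py']; first exact: in_Omega0_zero.
    exact: Omega0_linear.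
  rewrite (_ : omega = c *: mk_Omega0 px + mk_Omega0 py); last exact: val_inj.
  by apply: (@hspan_cons _ _ _ _ u) => //; apply: IH.
move=> w s us hw e u su; apply: val_inj.
apply: (form_independent us (w := fun v => val (w v)) hw _ su).
by rewrite -(lin_sum (F := val) s w) ?e.
Qed.

Lemma wedge0_linl (beta : Omega0 W) : linear (fun alpha => wedge0 alpha beta).
Proof. by move=> c x y; apply: val_inj; exact: wedge_linl. Qed.

Lemma wedge0_linr (alpha : Omega0 W) : linear (wedge0 alpha).
Proof. by move=> c x y; apply: val_inj; exact: wedge_linr. Qed.

Lemma const0_linear : linear (@const0 K G rho A W).
Proof. by move=> c f g; apply: val_inj; exact: const_linear. Qed.

(** The unit factor puts the differential in the form of the generators of
    [Omega0]; it is removed in [dfun0E]. *)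
Definition dfun0 f : Omega0 W := mk_Omega0 (in_Omega0_dfun f 1).

Lemma dfun0E f : val (dfun0 f) = dfun f.
Proof.
apply: val_inj; apply/funext => s; rewrite /= -[RHS]mulr1.
exact: (wedge_right W).
Qed.

(** The set where two derivations agree contains products of homogeneous
    elements of it, hence everything that functions and differentials generate. *)
Lemma rho_derivation_eq u (D E : Omega0 W -> Omega0 W) :
  is_rho_derivation (rho' (rho := rho)) (@Omega0_hom K G rho A W) (@wedge0 _ _ _ _ W) u D ->
  is_rho_derivation (rho' (rho := rho)) (@Omega0_hom K G rho A W) (@wedge0 _ _ _ _ W) u E ->
  (forall f, D (const0 W f) = E (const0 W f)) -> (forall f, D (dfun0 f) = E (dfun0 f)) ->
  D = E.
Proof.
move=> [[lD _] dD] [[lE _] dE] ec ed; apply/funext => omega.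
pose P al := exists x : Omega0 W, val x = al /\ D x = E x.
have : hom_sum P (val omega).
  apply: Omega0_hom_sum (Omega0P omega) => [a f _|a b f g hf hg|v w al be hal hbe].
  - by exists (const0 W f).
  - exists (wedge0 (dfun0 f) (const0 W g)); split; first by rewrite -(dfun0E f).
    have hd : Omega0_hom (1, a) (dfun0 f).
      by move: (dfun_hom hf); rewrite -(dfun0E f).
    by rewrite (dD _ _ _ hd) (dE _ _ _ hd) ec ed.
  move=> [x [ex Dx]] [y [ey Dy]]; exists (wedge0 x y).
  split; first by rewrite -ex -ey.
  have hx : Omega0_hom v x by rewrite /Omega0_hom /= ex.
  by rewrite (dD _ _ _ hx) (dE _ _ _ hx) Dx Dy.
move eal: (val omega) => al hs.
elim: hs omega eal => [|c v x y _ [x0 [ex Dx]] _ IH] omega eo.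
  by rewrite (_ : omega = 0) ?(lin0 lD) ?(lin0 lE) //; apply: val_inj.
have e : omega = c *: x0 + (omega - c *: x0) by rewrite addrC subrK.
rewrite e lD lE Dx IH //.
by rewrite /= eo ex addrC addKr.
Qed.


(** * The bracket of derivations *)

Let comp_linl (Y : rder A) : linear (fun X : rder A => (X : A -> A) \o (Y : A -> A)).
Proof. by []. Qed.

Let comp_linr (X : rder A) : linear (fun Y : rder A => (X : A -> A) \o (Y : A -> A)).
Proof. by move=> c Y Z; apply/funext => f; exact: rder_linear. Qed.

Lemma rder_bracket_linl Y : linear (fun X : rder A => rder_bracket X Y).
Proof.
move=> c X Z; apply: val_inj.
exact: (rho_comm_linl rho (rder_grading A) comp_linl comp_linr).
Qed.

Lemma rder_bracket_linr X : linear (fun Y : rder A => rder_bracket X Y).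
Proof.
move=> c Y Z; apply: val_inj.
exact: (rho_comm_linr rho (rder_grading A) comp_linl comp_linr).
Qed.

Lemma rder_bracket_hom a b (X Y : rder A) f : rder_hom a X -> rder_hom b Y ->
  rder_bracket X Y f = X (Y f) - rho a b *: Y (X f).
Proof.
move=> hX hY; rewrite {1}/rder_fun /=.
by rewrite (rho_comm_hom rho (rder_grading A) comp_linl comp_linr hX hY).
Qed.

Lemma rder_bracket_degree a b (X Y : rder A) : rder_hom a X -> rder_hom b Y ->
  rder_hom (a + b) (rder_bracket X Y).
Proof.
move=> hX hY; rewrite /rder_hom /dhom /=.
rewrite (rho_comm_hom rho (rder_grading A) comp_linl comp_linr hX hY).
exact: der_hom_comm.
Qed.

(** * Interior and Lie derivatives on the generated forms *)

Local Notation homO := (@Omega0_hom K G rho A W).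
Local Notation is_der := (is_rho_derivation (rho' (rho := rho)) homO (@wedge0 _ _ _ _ W)).
Local Notation ifun X := (section_fun (i_ W X)).

Lemma interior0_linear c X Y : ifun (c *: X + Y) = c *: ifun X + ifun Y.
Proof. by apply/funext => al; apply: val_inj; exact: interior_linl. Qed.

Lemma interior0_derivation a X : rder_hom a X -> is_der (-1, a) (ifun X).
Proof.
move=> hX; have [[lX hh] dX] := wedge_interior W hX.
split; first split.
- by move=> c al be; apply: val_inj; exact: interior_linr.
- by move=> i al; apply: hh.
by move=> i al be hal; apply: val_inj; exact: dX hal.
Qed.

Lemma interior0_const X f : ifun X (const0 W f) = 0.
Proof. by apply: val_inj; exact: interior_const. Qed.

Lemma interior0_dfun X f : ifun X (dfun0 f) = const0 W (X f).
Proof. by apply: val_inj; rewrite -[LHS]/(interior X (val (dfun0 f))) dfun0E interior_dfun. Qed.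

Lemma interior0_span X : hspan (hom_map homO) (ifun X).
Proof.
elim/(@rder_ind K G rho A): X => [|c X Y sX sY|a X hX].
- have := interior0_linear (-1) 0 0; rewrite scaler0 addr0 scaleN1r addNr => ->.
  exact: hspan_zero.
- by rewrite interior0_linear; apply: hspan_linear.
exact: hspan_hom (interior0_derivation hX).1.
Qed.

Section DeRham.
Variable d : Omega0 W -> Omega0 W.
Hypothesis hd : is_deRham d.

Lemma deRham_dfun f : d (const0 W f) = dfun0 f.
Proof. by apply: val_inj; rewrite dfun0E (deRham_const hd). Qed.

Let d_der : is_der (1, 0) d := deRham_derivation hd.
Let d_span : hspan (hom_map homO) d := hspan_hom d_der.1.

Lemma map_comm_derivation u v D E : is_der u D -> is_der v E -> is_der (u + v) (map_comm D E).
Proof.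
move=> hD hE; rewrite /map_comm (rho_comm_map_hom Omega0_grading _ hD.1 hE.1).
exact: (rho_derivation_comm (rho := rho'_cocycle) Omega0_grading wedge0_linl wedge0_linr).
Qed.

Lemma lie_linear c X Y :
  map_comm d (ifun (c *: X + Y)) = c *: map_comm d (ifun X) + map_comm d (ifun Y).
Proof.
rewrite interior0_linear.
by apply: (rho_comm_map_linr Omega0_grading) => //; apply: interior0_span.
Qed.

Lemma lie_span X : hspan (hom_map homO) (map_comm d (ifun X)).
Proof.
elim/(@rder_ind K G rho A): X => [|c X Y sX sY|a X hX].
- have := lie_linear (-1) 0 0; rewrite scaler0 addr0 scaleN1r addNr => ->.
  exact: hspan_zero.
- by rewrite lie_linear; apply: hspan_linear.
exact: hspan_hom (map_comm_derivation d_der (interior0_derivation hX)).1.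
Qed.

Section Homogeneous.
Variables (a b : G) (X Y : rder A).
Hypotheses (hX : rder_hom a X) (hY : rder_hom b Y).

Let dX := interior0_derivation hX.
Let dY := interior0_derivation hY.

(** The sign is [rho' (1,0) (-1,a) = - rho 0 a = -1]. *)
Lemma lieE omega :
  map_comm d (ifun X) omega = d (ifun X omega) + ifun X (d omega).
Proof.
rewrite /map_comm (rho_comm_map_hom Omega0_grading _ d_der.1 dX.1).
rewrite !fctE /= /rho' /= (_ : rho 0 a = 1); last first.
  by apply: (mulIf (cocycle_neq0 rho 0 a)); rewrite -cocycleD addr0 mul1r.
by rewrite mul1r mulr1 exprN1 invrN1 scaleN1r opprK.
Qed.

Lemma lie_const f : map_comm d (ifun X) (const0 W f) = const0 W (X f).
Proof.
by rewrite lieE interior0_const (lin0 d_der.1.1) deRham_dfun interior0_dfun add0r.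
Qed.

Lemma lie_dfun f : map_comm d (ifun X) (dfun0 f) = dfun0 (X f).
Proof.
rewrite lieE interior0_dfun deRham_dfun -(deRham_dfun f) (deRham_square hd).
by rewrite (lin0 dX.1.1) addr0.
Qed.

Lemma derived_bracketE omega :
  derived_bracket d (ifun X) (ifun Y) omega =
  map_comm d (ifun X) (ifun Y omega) - rho a b *: ifun Y (map_comm d (ifun X) omega).
Proof.
have dL := map_comm_derivation d_der dX.
rewrite /derived_bracket {1}/map_comm (rho_comm_map_hom Omega0_grading _ dL.1 dY.1).
by rewrite !fctE /= /rho' /= addrN mul0r expr0z mul1r add0r.
Qed.

Lemma derived_bracket_hom :
  derived_bracket d (ifun X) (ifun Y) = ifun (rder_bracket X Y).
Proof.
have dB := interior0_derivation (rder_bracket_degree hX hY).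
apply: rho_derivation_eq (map_comm_derivation (map_comm_derivation d_der dX) dY) _ _ _.
- rewrite (_ : _ + _ = (-1, a + b)) //.
  by congr pair; rewrite /= ?add0r.
- move=> f; rewrite -[LHS]/(derived_bracket d (ifun X) (ifun Y) _) derived_bracketE.
  rewrite lie_const !interior0_const scaler0 subr0.
  by rewrite (lin0 (map_comm_derivation d_der dX).1.1).
move=> f; rewrite -[LHS]/(derived_bracket d (ifun X) (ifun Y) _) derived_bracketE.
rewrite lie_dfun !interior0_dfun lie_const (rder_bracket_hom _ hX hY).
by rewrite addrC -scaleNr -const0_linear scaleNr addrC.
Qed.

End Homogeneous.

Lemma derived_bracket_linl Y :
  linear (fun X => derived_bracket d (ifun X) (ifun Y)).
Proof.
move=> c X Z; rewrite /derived_bracket lie_linear.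
by apply: (rho_comm_map_linl Omega0_grading); [exact: lie_span|exact: lie_span|exact: interior0_span].
Qed.

Lemma derived_bracket_linr X :
  linear (fun Y => derived_bracket d (ifun X) (ifun Y)).
Proof.
move=> c Y Z; rewrite /derived_bracket interior0_linear.
by apply: (rho_comm_map_linr Omega0_grading); [exact: lie_span|exact: interior0_span|exact: interior0_span].
Qed.

Lemma derived_bracket_interior X Y :
  derived_bracket d (ifun X) (ifun Y) = ifun (rder_bracket X Y).
Proof.
have sp := grading_span (rder_grading A).
apply: (linear_eq_hom sp (derived_bracket_linl Y)
  (H := fun X => ifun (rder_bracket X Y))) => [c U V|a {}X hX].
  by rewrite rder_bracket_linl interior0_linear.
apply: (linear_eq_hom sp (derived_bracket_linr X)
  (H := fun Y => ifun (rder_bracket X Y))) => [c U V|b {}Y hY].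
  by rewrite rder_bracket_linr interior0_linear.
exact: derived_bracket_hom hX hY.
Qed.

End DeRham.

End Forms.

Theorem mainTheorem4 (K : fieldType) (hK : real_or_complex K) (G : zmodType)
    (rho : cocycle K G) (A : acAlgebra rho) (W : wedge_product A)
    (d : Omega0 W -> Omega0 W) (hd : is_deRham d) (X Y : rder A) :
  derived_bracket d (i_ W X) (i_ W Y) = i_ W (rder_bracket X Y).
Proof. exact: derived_bracket_interior. Qed.
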